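(* The following connection formulas hold between the matrix Laurent polynomials associated with $\mu$ and with the Geronimus modified matrix of measures $\check\mu$, where $\mathrm d\mu(z)=W_{[q]}(z)\,\mathrm d\check\mu(z)$: $$N_G\,\check B(z)=B(z)\,W_{[q]}(z),\qquad N_G\,\check B^{(b)}(z)=B^{(b)}(z)\,W_b(z)\quad(b\in\{1,\dots,q\}),$$ $$A(z^{-1})\,N_G=\check A(z^{-1}),\qquad A^{(a)}(z^{-1})\,N_G=\check A^{(a)}(z^{-1})\quad(a\in\{1,\dots,p\}).$$
   Context: Let $p,q,d\in\mathbb N$. Rows and columns of semi-infinite matrices are indexed from $0$. For $r\in\mathbb N$, $Z_{[r]}(z)$ is the $\infty\times r$ matrix obtained by stacking the $r\times r$ blocks $I_r, z^{-1}I_r, zI_r, z^{-2}I_r, z^2I_r,\dots$ (block number $2N$ is $z^NI_r$, block number $2N+1$ is $z^{-N-1}I_r$). Let $W_{[q]}(z)=\mathrm{diag}(W_1(z),\dots,W_q(z))$, where each $W_b$ is a balanced Laurent polynomial $W_b(z)=c_bz^{-d}\prod_{\ell=1}^{2d}(z-z_{b,\ell})$, $c_b\neq0$, with $2d$ distinct nonzero zeros, the $2dq$ zeros $z_{b,\ell}$ being all different. Let $\mu,\check\mu$ be $q\times p$ matrices of complex Borel measures on the unit circle $\mathbb T$ with $\mathrm d\mu(z)=W_{[q]}(z)\,\mathrm d\check\mu(z)$. The moment matrices are $M=\oint_{\mathbb T}Z_{[q]}(z)\,\mathrm d\mu(z)\,Z_{[p]}^\top(z^{-1})$ and $\check M=\oint_{\mathbb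 T}Z_{[q]}(z)\,\mathrm d\check\mu(z)\,Z_{[p]}^\top(z^{-1})$. It is assumed that both have Gauss--Borel factorizations $M=L^{-1}U^{-1}$, $\check M=\check L^{-1}\check U^{-1}$, with $L,\check L$ lower triangular and $U,\check U$ upper triangular semi-infinite matrices with nonzero diagonal entries. Put $B(z)=LZ_{[q]}(z)$, $A(z^{-1})=Z_{[p]}^\top(z^{-1})U$, $\check B(z)=\check LZ_{[q]}(z)$, $\check A(z^{-1})=Z_{[p]}^\top(z^{-1})\check U$; superscript $(b)$ denotes the $b$-th column of $B,\check B$, and superscript $(a)$ the $a$-th row of $A,\check A$. $\Upsilon_{[q]}$ is the semi-infinite permutation matrix whose $q\times q$ blocks (block indices from $0$) are $I_q$ at block positions $(2k,2k+2)$, $k\ge0$, at $(1,0)$, and at $(2k+3,2k+1)$, $k\ge0$, and zero elsewhere. $I_{[q]}^{(b)}$ is the semi-infinite diagonal matrix with ones exactly at the diagonal positions $q\nu+b-1$, $\nu\in\mathbb N_0$. With $\Upsilon^{(b)}_{[q]}=\Upsilon_{[q]}I^{(b)}_{[q]}=I^{(b)}_{[q]}\Upsilon_{[q]}$, whose integer powers are understood as $(\Upsilon^{(b)}_{[q]})^k=\Upsilon_{[q]}^kI^{(b)}_{[q]}$, $k\in\mathbb Z$, set $\mathcal W=\sum_{b=1}^qW_b(\Upsilon_{[q]}^{(b)})$. One has $\mathcal W\check M=M$, and the connection matrix is $N_G=U^{-1}\check U=L\,\mathcal W\,\check L^{-1}$. *)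

(* Defs.v *)
From HB Require Import structures.
From mathcomp Require Export all_boot all_order all_algebra complex.
From mathcomp Require Export all_classical all_reals all_analysis.

Set Implicit Arguments.
Unset Strict Implicit.
Unset Printing Implicit Defensive.

Export Order.TTheory GRing.Theory Num.Theory numFieldNormedType.Exports.

Local Open Scope classical_set_scope.
Local Open Scope ring_scope.
Local Open Scope complex_scope.

Section ComplexMeasure.
Context {d : measure_display} {T : measurableType d} {R : realType}.
Local Open Scope charge_scope.

Definition hahn_pos (nu : {charge set T -> \bar R}) : set T :=
  sval (cid (Hahn_decomposition nu)).

Definition hahn_neg (nu : {charge set T -> \bar R}) : set T :=
  sval (cid (svalP (cid (Hahn_decomposition nu)))).

Lemma hahn_posneg (nu : {charge set T -> \bar R}) :
  hahn_decomposition nu (hahn_pos nu) (hahn_neg nu).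
Proof. exact: svalP (cid (svalP (cid (Hahn_decomposition nu)))). Qed.

(* The Jordan parts do not depend on the chosen Hahn decomposition
   (Hahn_decomposition_uniq). *)
Definition charge_integral (nu : {charge set T -> \bar R}) (D : set T)
    (f : T -> R) : R :=
  \int[jordan_pos (hahn_posneg nu)]_(x in D) f x
  - \int[jordan_neg (hahn_posneg nu)]_(x in D) f x.

(* A charge is a finite signed measure, so a complex measure is a pair of
   charges. *)
Record complex_measure := ComplexMeasure {
  re_charge : {charge set T -> \bar R} ;
  im_charge : {charge set T -> \bar R} }.

Definition cmeasure (mu : complex_measure) (E : set T) : R[i] :=
  fine (re_charge mu E) +i* fine (im_charge mu E).

Definition cintegral (mu : complex_measure) (D : set T) (f : T -> R[i]) : R[i] :=
  (charge_integral (re_charge mu) D (fun x => complex.Re (f x))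
   - charge_integral (im_charge mu) D (fun x => complex.Im (f x)))
  +i*
  (charge_integral (re_charge mu) D (fun x => complex.Im (f x))
   + charge_integral (im_charge mu) D (fun x => complex.Re (f x))).

End ComplexMeasure.
Arguments complex_measure {d} T R.

Section Circle.
Variable R : realType.

Definition unit_circle : set (R[i])^o := [set z | `|z| = 1].

(* set_type carries the subspace topology. *)
Definition circle := set_type unit_circle.

HB.instance Definition _ := Topological.on circle.

Lemma unit_circle1 : (1 : (R[i])^o) \in unit_circle.
Proof. by rewrite inE /unit_circle /= normr1. Qed.

HB.instance Definition _ :=
  isPointed.Build circle (exist _ (1 : (R[i])^o) unit_circle1).

Definition borel_circle := g_sigma_algebraType (@open circle).

Definition circle_val (z : borel_circle) : R[i] :=
  set_val (z : set_type unit_circle).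

End Circle.

(* A matrix with rows indexed by I and columns by J is a function
   I -> J -> C.  The index type nat gives a semi-infinite direction, with
   indices starting at 0, and 'I_n a finite one. *)

Section InfiniteMatrix.
Variable C : numFieldType.

(* The sum has finitely many nonzero terms for all the products used below;
   if it had not, its value would be 0 by convention. *)
Definition imul (I J : Type) (K : choiceType) (X : I -> K -> C)
    (Y : K -> J -> C) : I -> J -> C :=
  fun i j => \sum_(k \in [set: K]) (X i k * Y k j).

Definition itr (I J : Type) (X : I -> J -> C) : J -> I -> C := fun j i => X i j.

Definition icol (I J : Type) (j : J) (X : I -> J -> C) : I -> 'I_1 -> C :=
  fun i _ => X i j.

Definition irow (I J : Type) (i : I) (X : I -> J -> C) : 'I_1 -> J -> C :=
  fun _ j => X i j.

Definition iscale (I J : Type) (X : I -> J -> C) (a : C) : I -> J -> C :=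
  fun i j => X i j * a.

Definition idiag (I : eqType) (D : I -> C) : I -> I -> C :=
  fun i j => if i == j then D i else 0.

Definition iid : nat -> nat -> C := idiag (fun=> 1).

(* The two-sided inverse, which is unique for triangular and permutation
   matrices. *)
Definition iinv (X : nat -> nat -> C) : nat -> nat -> C :=
  xget (fun _ _ => 0) [set Y | imul X Y = iid /\ imul Y X = iid].

Definition ipow (X : nat -> nat -> C) (k : int) : nat -> nat -> C :=
  match k with
  | Posz n => iter n (imul X) iid
  | Negz n => iter n.+1 (imul (iinv X)) iid
  end.

Definition ilower (X : nat -> nat -> C) := forall i j, (i < j)%N -> X i j = 0.
Definition iupper (X : nat -> nat -> C) := forall i j, (j < i)%N -> X i j = 0.

Definition gauss_borel (M L U : nat -> nat -> C) : Prop :=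
  [/\ ilower L, iupper U, forall i, L i i != 0, forall i, U i i != 0
    & M = imul (iinv L) (iinv U)].

End InfiniteMatrix.

Notation "X ** Y" := (imul X Y) (at level 40, left associativity).

(* The indices b = 1, ..., q and a = 1, ..., p are the elements of 'I_q and
   'I_p, so they are shifted by one: b here stands for the number b + 1. *)

Section LaurentMonomials.
Variable C : numFieldType.

Definition block_monomial (m : nat) (z : C) : C :=
  if odd m then z ^- (m./2).+1 else z ^+ m./2.

Definition Zmx (r : nat) (z : C) : nat -> 'I_r -> C :=
  fun i s => if (i %% r)%N == s then block_monomial (i %/ r)%N z else 0.

Arguments Zmx r z : clear implicits.

(* The shift for which Upsilon q ** Zmx q z = z Zmx q z: its q x q block at
   block position (m, n) is the identity if upsilon_block m n, else 0. *)
Definition upsilon_block (m n : nat) : bool :=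
  [|| ~~ odd m && (n == m + 2)%N,
      (m == 1)%N && (n == 0)%N
    | odd m && (m == n + 2)%N].

Definition Upsilon (q : nat) : nat -> nat -> C :=
  fun i j => (upsilon_block (i %/ q)%N (j %/ q)%N && (i %% q == j %% q)%N)%:R.

Definition Iproj (q : nat) (b : 'I_q) : nat -> nat -> C :=
  idiag (fun i => (i %% q == b)%N%:R).

Definition Upsilon_pow (q : nat) (b : 'I_q) (k : int) : nat -> nat -> C :=
  ipow (Upsilon q) k ** Iproj b.

(* W_b is z^(-d) times this polynomial of degree 2d. *)
Definition Wnum (q d : nat) (c : 'I_q -> C) (zeta : 'I_q -> 'I_(2 * d) -> C)
    (b : 'I_q) : {poly C} :=
  c b *: \prod_(l < 2 * d) ('X - (zeta b l)%:P).

Definition Wlaurent (q d : nat) (c : 'I_q -> C)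
    (zeta : 'I_q -> 'I_(2 * d) -> C) (b : 'I_q) (z : C) : C :=
  z ^- d * (Wnum c zeta b).[z].

Definition Wdiag (q d : nat) (c : 'I_q -> C)
    (zeta : 'I_q -> 'I_(2 * d) -> C) (z : C) : 'I_q -> 'I_q -> C :=
  idiag (fun b => Wlaurent c zeta b z).

(* The sum over b of W_b(Upsilon^(b)); the coefficient of z^(k - d) in W_b
   is that of 'X^k in Wnum. *)
Definition Wcal (q d : nat) (c : 'I_q -> C)
    (zeta : 'I_q -> 'I_(2 * d) -> C) : nat -> nat -> C :=
  fun i j => \sum_(b < q) \sum_(k < (2 * d).+1)
    (Wnum c zeta b)`_k * Upsilon_pow b (k%:Z - d%:Z) i j.

Definition Bpoly (q : nat) (L : nat -> nat -> C) (z : C) : nat -> 'I_q -> C :=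
  L ** Zmx q z.

(* This is A(z), to be evaluated at the inverse of the spectral variable. *)
Definition Apoly (p : nat) (U : nat -> nat -> C) (z : C) : 'I_p -> nat -> C :=
  itr (Zmx p z) ** U.

End LaurentMonomials.
Arguments Zmx {C} r z.
Arguments Upsilon {C} q.
Arguments Iproj {C q} b.
Arguments Upsilon_pow {C q} b k.
Arguments Bpoly {C} q L z.
Arguments Apoly {C} p U z.

Definition moment_matrix (R : realType) (q p : nat)
    (mu : 'M[complex_measure (borel_circle R) R]_(q, p)) : nat -> nat -> R[i] :=
  fun i j => \sum_(b < q) \sum_(a < p)
    cintegral (mu b a) setT
      (fun z => Zmx q (circle_val z) i b * Zmx p (circle_val z)^-1 j a).

(* d mu = W_[q] d mu_check: W_[q] is diagonal, so the (b, a) entry of mu has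
   density W_b with respect to that of mu_check. *)
Definition geronimus (R : realType) (q p d : nat) (c : 'I_q -> R[i])
    (zeta : 'I_q -> 'I_(2 * d) -> R[i])
    (mu muc : 'M[complex_measure (borel_circle R) R]_(q, p)) : Prop :=
  forall (b : 'I_q) (a : 'I_p) (E : set (borel_circle R)), measurable E ->
    cmeasure (mu b a) E =
    cintegral (muc b a) E (fun z => Wlaurent c zeta b (circle_val z)).

(* Main.v *)
(* The Laurent monomials form an eigenvector of the shift, Upsilon Z(z) = z Z(z),
   so calligraphic W satisfies W Z_[q](z) = Z_[q](z) W_[q](z).  Integrating this
   identity against the measures gives W M_check = M; all that is needed there
   is that a density identity on Borel sets passes to integrals of bounded
   measurable functions.  Inserting the two Gauss-Borel factorizations yields
   U^-1 Uc = L W Lc^-1: the first form of N_G is column-finite and the second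
   row-finite, which justifies the reassociations in A N_G and in N_G B_check
   respectively. *)
Require Import Defs.
From mathcomp Require Import measurable_realfun ring lra zify.

Set Implicit Arguments.
Unset Strict Implicit.
Unset Printing Implicit Defensive.

Local Open Scope classical_set_scope.
Local Open Scope ring_scope.
Local Open Scope complex_scope.

(** * Integration against complex measures *)

Section BoundedMeasurable.
Context {d : measure_display} {T : measurableType d} {R : realType}.
Implicit Types (f g : T -> R) (nu : {charge set T -> \bar R}).

Definition bounded_measurable f :=
  measurable_fun setT f /\ exists M, forall x, `|f x| <= M.

Lemma bounded_measurable_cst (a : R) : bounded_measurable (fun=> a).
Proof. by split; [exact: measurable_cst | exists `|a|]. Qed.

Lemma bounded_measurable_indic (E : set T) :
  measurable E -> bounded_measurable (\1_E : T -> R).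
Proof.
move=> mE; split; first exact: measurable_indic.
by exists 1 => x; rewrite indicE; case: (_ \in _); rewrite ?normr1 ?normr0.
Qed.

Lemma bounded_measurableD f g : bounded_measurable f -> bounded_measurable g ->
  bounded_measurable (fun x => f x + g x).
Proof.
move=> [mf [M fM]] [mg [N gN]]; split; first exact: measurable_funD.
by exists (M + N) => x; rewrite (le_trans (ler_normD _ _))// lerD.
Qed.

Lemma bounded_measurableM f g : bounded_measurable f -> bounded_measurable g ->
  bounded_measurable (fun x => f x * g x).
Proof.
move=> [mf [M fM]] [mg [N gN]]; split; first exact: measurable_funM.
by exists (M * N) => x; rewrite normrM ler_pM.
Qed.

Lemma bounded_measurableZ a f : bounded_measurable f ->
  bounded_measurable (fun x => a * f x).
Proof. exact/bounded_measurableM/bounded_measurable_cst. Qed.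

Lemma bounded_measurableN f : bounded_measurable f ->
  bounded_measurable (fun x => - f x).
Proof.
by move=> /(bounded_measurableZ (-1)); under eq_fun do rewrite mulN1r.
Qed.

Lemma bounded_measurableB f g : bounded_measurable f -> bounded_measurable g ->
  bounded_measurable (fun x => f x - g x).
Proof. by move=> bf /bounded_measurableN; exact: bounded_measurableD. Qed.

Lemma bounded_measurable_integrable (m : {finite_measure set T -> \bar R}) f :
  bounded_measurable f -> m.-integrable setT (EFin \o f).
Proof.
move=> [mf [M fM]]; apply: measurable_bounded_integrable => //.
  by rewrite ltey_eq fin_num_measure.
exists M; split; first exact: num_real.
by move=> N MN x _; exact: le_trans (fM x) (ltW MN).
Qed.

(** Abstracts what integrals against charges and against densities share, so that differences of
    such integrals can be tested on indicators alone. The last field is continuity in the sup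
    norm. *)
Record bounded_linear (I : (T -> R) -> R) : Prop := BoundedLinear {
  bounded_linearD : forall f g, bounded_measurable f -> bounded_measurable g ->
    I (fun x => f x + g x) = I f + I g ;
  bounded_linearZ : forall a f, bounded_measurable f ->
    I (fun x => a * f x) = a * I f ;
  bounded_linear_le : exists K, 0 <= K /\ forall f M, bounded_measurable f ->
    (forall x, `|f x| <= M) -> `|I f| <= K * M }.

Lemma bounded_linear_sub I J : bounded_linear I -> bounded_linear J ->
  bounded_linear (fun f => I f - J f).
Proof.
move=> [ID IZ [K [K0 IK]]] [JD JZ [K' [K'0 JK]]]; split.
- by move=> f g bf bg; rewrite ID// JD//; ring.
- by move=> a f bf; rewrite IZ// JZ// mulrBr.
- exists (K + K'); split=> [|f M bf fM]; first exact: addr_ge0.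
  by rewrite (le_trans (ler_normB _ _))// mulrDl lerD// ?IK// JK.
Qed.

Lemma bounded_linear_opp I : bounded_linear I ->
  bounded_linear (fun f => - I f).
Proof.
move=> [ID IZ [K [K0 IK]]]; split.
- by move=> f g bf bg; rewrite ID// opprD.
- by move=> a f bf; rewrite IZ// mulrN.
- by exists K; split=> // f M bf fM; rewrite normrN IK.
Qed.

Lemma bounded_linear_density I g : bounded_linear I -> bounded_measurable g ->
  bounded_linear (fun f => I (fun x => f x * g x)).
Proof.
move=> [ID IZ [K [K0 IK]]] bg; have [mg [N gN]] := bg; split.
- move=> f f' bf bf'; under eq_fun do rewrite mulrDl.
  by rewrite ID//; exact: bounded_measurableM.
- move=> a f bf; under eq_fun do rewrite -mulrA.
  by rewrite IZ//; exact: bounded_measurableM.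
(* [|N|] makes the constant nonnegative without exhibiting a point of [T]. *)
- exists (K * `|N|); split=> [|f M bf fM]; first exact: mulr_ge0.
  rewrite -mulrA [`|N| * M]mulrC; apply: IK; first exact: bounded_measurableM.
  move=> x; rewrite normrM ler_pM// (le_trans (gN x))//.
  exact: ler_norm.
Qed.

(* A function with values in [0, 1] is f = (1_E + g) / 2 with E = {f >= 1/2} and
   g = 2 f - 1_E again with values in [0, 1]; hence |I f| = |I g| / 2. *)
Lemma bounded_linear_eq0 I : bounded_linear I ->
  (forall E : set T, measurable E -> I \1_E = 0) ->
  forall f, bounded_measurable f -> I f = 0.
Proof.
move=> [ID IZ [K [K0 IK]]] I1.
have dyadic n f : bounded_measurable f -> (forall x, 0 <= f x <= 1) ->
    `|I f| <= K * 2^-1 ^+ n.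
  elim: n f => [|n IHn] f bf f01.
    rewrite expr0; apply: IK => // x.
    by have /andP[f0 f1] := f01 x; rewrite ger0_norm.
  pose E := [set x | 2^-1 <= f x].
  have mE : measurable E.
    rewrite (_ : E = f @^-1` `[2^-1, +oo[%classic).
      by rewrite -[_ @^-1` _]setTI; apply: bf.1.
    by apply/seteqP; split=> x; rewrite /E /= in_itv /= andbT.
  have b1 := bounded_measurable_indic mE.
  pose g x := 2 * f x - \1_E x.
  have bg : bounded_measurable g.
    exact/bounded_measurableB/b1/bounded_measurableZ.
  have g01 x : 0 <= g x <= 1.
    have := f01 x; rewrite /g indicE; case: (boolP (x \in E)) => /=.
      by rewrite inE /E /= => Ex; lra.
    by rewrite notin_setE /E /= => /negP; rewrite -ltNge => Ex; lra.
  have -> : f = fun x => 2^-1 * (g x + \1_E x).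
    by apply/funext => x; rewrite /g; field.
  rewrite IZ; last exact: bounded_measurableD.
  rewrite ID// I1// addr0 normrM ger0_norm ?invr_ge0// exprS mulrCA.
  by rewrite ler_pM2l ?IHn.
(* If [I f] were nonzero, some [n] would satisfy K < n |I f| <= 2^n |I f|, against the dyadic
   bound. *)
have I01 f : bounded_measurable f -> (forall x, 0 <= f x <= 1) -> I f = 0.
  move=> bf f01; apply/eqP; rewrite -normr_eq0; apply: contraT => If0.
  have {}If0 : 0 < `|I f| by rewrite lt_def If0 normr_ge0.
  have [n Kn] : exists n : nat, K / `|I f| < n%:R.
    exists (Num.bound (K / `|I f|)); rewrite archi_boundP//.
    by rewrite divr_ge0// ltW.
  have := dyadic n f bf f01; rewrite exprVn ler_pdivlMr ?exprn_gt0// leNgt.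
  move=> /negP[]; rewrite mulrC -ltr_pdivrMr// (lt_le_trans Kn)//.
  by rewrite -natrX ler_nat ltnW// ltn_expl.
move=> f bf; have [_ [M fM]] := bf.
(* The general case is an affine rescaling: [h] takes values in [0, 1], and f = 2N h - N 1_T, where
   [I] kills both terms. Adding 1 keeps [N] invertible. *)
pose N := `|M| + 1; have N0 : 0 < N by rewrite ltr_wpDl.
have fN x : - N <= f x <= N.
  by rewrite -ler_norml (le_trans (fM x))// (le_trans (ler_norm _))// lerDl.
pose h x := (2 * N)^-1 * (f x + N).
have bh : bounded_measurable h.
  exact/bounded_measurableZ/bounded_measurableD/bounded_measurable_cst.
have bT : bounded_measurable (\1_(setT : set T) : T -> R).
  exact: bounded_measurable_indic.
have -> : f = fun x => (2 * N) * h x + (- N) * \1_(setT : set T) x.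
  apply/funext => x; rewrite indicT /h /cst; field.
  by rewrite gt_eqF.
rewrite ID; try exact: bounded_measurableZ.
rewrite (IZ _ _ bh) (IZ _ _ bT) I1// mulr0 addr0 I01 ?mulr0// => x.
have := fN x; rewrite /h mulrC ler_pdivlMr ?mulr_gt0// ler_pdivrMr ?mulr_gt0//.
by move=> /andP[? ?]; apply/andP; split; lra.
Qed.

(** Turns a density identity, which integrates over [E], into one between functionals on the whole
    space evaluated at the indicator of [E]. *)
Lemma charge_integral_indicl nu (E : set T) f :
  charge_integral nu E f = charge_integral nu setT (fun x => \1_E x * f x).
Proof.
by rewrite /charge_integral; congr (_ - _); rewrite Rintegral_mkcond;
  apply: eq_Rintegral => x _; rewrite patchE indicE;
  case: (x \in E); rewrite ?mul1r ?mul0r.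
Qed.

(** This is the Jordan decomposition evaluated at [E]; both parts are finite, so [fine] commutes
    with the difference. *)
Lemma charge_integral_indic nu (E : set T) : measurable E ->
  charge_integral nu setT \1_E = fine (nu E).
Proof.
move=> mE; rewrite /charge_integral /Rintegral !integral_indic// !setIT.
rewrite [in RHS](jordan_decomp (hahn_posneg nu) mE) /cadd /= cscaleN1.
by rewrite fineB// fin_num_measure.
Qed.

Lemma bounded_linear_Rintegral (m : {finite_measure set T -> \bar R}) :
  bounded_linear (fun f => \int[m]_x f x).
Proof.
split.
- move=> f g bf bg; apply: RintegralD => //.
  + exact: bounded_measurable_integrable.
  + exact: bounded_measurable_integrable.
- move=> a f bf; apply: RintegralZl => //.
  exact: bounded_measurable_integrable.
(* The constant is the total mass. *)
- exists (fine (m setT)); split; first exact: fine_ge0.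
  move=> f M bf fM; rewrite mulrC -Rintegral_cst//.
  apply: le_trans (le_normr_Rintegral _ _) _ => //.
    exact: bounded_measurable_integrable.
  apply: le_Rintegral => //.
  + exact/integrable_norm/bounded_measurable_integrable.
  + exact/bounded_measurable_integrable/bounded_measurable_cst.
Qed.

Lemma bounded_linear_charge nu : bounded_linear (charge_integral nu setT).
Proof. by apply: bounded_linear_sub; exact: bounded_linear_Rintegral. Qed.

End BoundedMeasurable.

(** * Complex integrals and change of density *)

Section ComplexIntegral.
Context {d : measure_display} {T : measurableType d} {R : realType}.
Implicit Types (f g w : T -> R[i]) (m mu muc : complex_measure T R).

Definition cbounded_measurable f :=
  bounded_measurable (fun x => complex.Re (f x)) /\
  bounded_measurable (fun x => complex.Im (f x)).

Lemma ReM (x y : R[i]) : complex.Re (x * y) =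
  complex.Re x * complex.Re y - complex.Im x * complex.Im y.
Proof. by case: x => a b; case: y. Qed.

Lemma ImM (x y : R[i]) : complex.Im (x * y) =
  complex.Re x * complex.Im y + complex.Im x * complex.Re y.
Proof. by case: x => a b; case: y. Qed.

Lemma ReD (x y : R[i]) : complex.Re (x + y) = complex.Re x + complex.Re y.
Proof. by case: x => a b; case: y. Qed.

Lemma ImD (x y : R[i]) : complex.Im (x + y) = complex.Im x + complex.Im y.
Proof. by case: x => a b; case: y. Qed.

Lemma cbounded_measurable_cst (a : R[i]) : cbounded_measurable (fun=> a).
Proof. by split; exact: bounded_measurable_cst. Qed.

Lemma cbounded_measurableD f g : cbounded_measurable f ->
  cbounded_measurable g -> cbounded_measurable (fun x => f x + g x).
Proof.
move=> [f1 f2] [g1 g2]; split.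
- by under eq_fun do rewrite ReD; exact: bounded_measurableD.
- by under eq_fun do rewrite ImD; exact: bounded_measurableD.
Qed.

Lemma cbounded_measurableM f g : cbounded_measurable f ->
  cbounded_measurable g -> cbounded_measurable (fun x => f x * g x).
Proof.
move=> [f1 f2] [g1 g2]; split.
- by under eq_fun do rewrite ReM; apply: bounded_measurableB;
    exact: bounded_measurableM.
- by under eq_fun do rewrite ImM; apply: bounded_measurableD;
    exact: bounded_measurableM.
Qed.

Lemma cbounded_measurableX f n : cbounded_measurable f ->
  cbounded_measurable (fun x => f x ^+ n).
Proof.
move=> bf; elim: n => [|n IHn]; first exact: cbounded_measurable_cst.
by under eq_fun do rewrite exprS; exact: cbounded_measurableM.
Qed.

Lemma cbounded_measurable_sum (I : Type) (s : seq I) (F : I -> T -> R[i]) :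
  (forall k, cbounded_measurable (F k)) ->
  cbounded_measurable (fun x => \sum_(k <- s) F k x).
Proof.
move=> bF; elim: s => [|k s IHs].
  by under eq_fun do rewrite big_nil; exact: cbounded_measurable_cst.
by under eq_fun do rewrite big_cons; exact: cbounded_measurableD.
Qed.

(** The combination a f + g is exactly the induction step for finite sums. A complex scalar mixes
    real and imaginary parts, so both parts are expanded before real linearity applies. *)
Lemma cintegral_linear m a f g : cbounded_measurable f ->
  cbounded_measurable g ->
  cintegral m setT (fun x => a * f x + g x) =
  a * cintegral m setT f + cintegral m setT g.
Proof.
move=> [f1 f2] [g1 g2]; rewrite /cintegral.
have re x : complex.Re (a * f x + g x) = complex.Re a * complex.Re (f x) +
    ((- complex.Im a) * complex.Im (f x) + complex.Re (g x)).
  by rewrite ReD ReM; ring.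
have im x : complex.Im (a * f x + g x) = complex.Re a * complex.Im (f x) +
    (complex.Im a * complex.Re (f x) + complex.Im (g x)).
  by rewrite ImD ImM; ring.
under [fun x => complex.Re (a * _ + _)]eq_fun do rewrite re.
under [fun x => complex.Im (a * _ + _)]eq_fun do rewrite im.
have lin (nu : {charge set T -> \bar R}) := bounded_linear_charge nu.
rewrite !(bounded_linearD (lin _)) ?(bounded_linearZ (lin _))//;
  try (by repeat first [exact: bounded_measurableZ
                       | apply: bounded_measurableD]).
by apply/eqP; rewrite eq_complex ReD ImD ReM ImM /=; apply/andP; split;
  apply/eqP; ring.
Qed.

Lemma cintegral0 m : cintegral m setT (fun=> 0) = 0.
Proof.
have b0 := cbounded_measurable_cst 0.
(* With [a = 1] and both functions zero, linearity says that the integral equals its own double. *)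
have := cintegral_linear m 1 b0 b0; rewrite mul1r addr0 mul1r.
by move=> /eqP; rewrite -subr_eq0 opprD addrA subrr sub0r oppr_eq0 => /eqP.
Qed.

Lemma cintegral_sum m (I : Type) (s : seq I) (a : I -> R[i])
    (F : I -> T -> R[i]) : (forall k, cbounded_measurable (F k)) ->
  cintegral m setT (fun x => \sum_(k <- s) a k * F k x) =
  \sum_(k <- s) a k * cintegral m setT (F k).
Proof.
move=> bF; elim: s => [|k s IHs].
  by under eq_fun do rewrite big_nil; rewrite cintegral0 big_nil.
under eq_fun do rewrite big_cons.
rewrite cintegral_linear// ?IHs ?big_cons//.
apply: cbounded_measurable_sum => j.
exact/cbounded_measurableM/bF/cbounded_measurable_cst.
Qed.

(** The real and imaginary parts of the identity on sets determine the two charges of [mu]. Each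
    resulting real identity extends from indicators by [bounded_linear_eq0], and the parts are then
    recombined. *)
Lemma cintegral_density mu muc w : cbounded_measurable w ->
  (forall E, measurable E -> cmeasure mu E = cintegral muc E w) ->
  forall f, cbounded_measurable f ->
  cintegral mu setT f = cintegral muc setT (fun x => f x * w x).
Proof.
move=> [w1 w2] muE.
have lin (nu : {charge set T -> \bar R}) (g : T -> R) : bounded_measurable g ->
    bounded_linear (fun h => charge_integral nu setT (fun x => h x * g x)).
  exact/bounded_linear_density/bounded_linear_charge.
have re (g : T -> R) : bounded_measurable g ->
    charge_integral (re_charge mu) setT g =
    charge_integral (re_charge muc) setT (fun x => g x * complex.Re (w x)) -
    charge_integral (im_charge muc) setT (fun x => g x * complex.Im (w x)).
  (* The difference of the two sides, as a functional of [g], is bounded linear and vanishes on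
     indicators. *)
  move=> bg; apply/eqP; rewrite -subr_eq0; apply/eqP; move: g bg.
  apply: bounded_linear_eq0 => [|E mE].
    apply: bounded_linear_sub; first exact: bounded_linear_charge.
    by apply: bounded_linear_sub; exact: lin.
  have [+ _] := muE E mE; rewrite charge_integral_indic// => ->.
  by rewrite -!charge_integral_indicl subrr.
(* The sum is written as a double subtraction to fit [bounded_linear_sub] and
   [bounded_linear_opp]. *)
have im (g : T -> R) : bounded_measurable g ->
    charge_integral (im_charge mu) setT g =
    charge_integral (re_charge muc) setT (fun x => g x * complex.Im (w x)) -
    - charge_integral (im_charge muc) setT (fun x => g x * complex.Re (w x)).
  move=> bg; apply/eqP; rewrite -subr_eq0; apply/eqP; move: g bg.
  apply: bounded_linear_eq0 => [|E mE].
    apply: bounded_linear_sub; first exact: bounded_linear_charge.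
    by apply: bounded_linear_sub; last apply: bounded_linear_opp; exact: lin.
  have [_ +] := muE E mE; rewrite charge_integral_indic// => ->.
  by rewrite -!charge_integral_indicl opprK subrr.
move=> f [f1 f2]; rewrite /cintegral !re// !im//.
under [fun x => complex.Re (_ * _)]eq_fun do rewrite ReM.
under [fun x => complex.Im (_ * _)]eq_fun do rewrite ImM.
have L (nu : {charge set T -> \bar R}) := bounded_linear_charge nu.
have sub (nu : {charge set T -> \bar R}) (g h : T -> R) :
    bounded_measurable g -> bounded_measurable h ->
    charge_integral nu setT (fun x => g x - h x) =
    charge_integral nu setT g - charge_integral nu setT h.
  move=> bg bh; under eq_fun do rewrite -mulN1r.
  rewrite (bounded_linearD (L _)) ?(bounded_linearZ (L _)) ?mulN1r//.
  exact: bounded_measurableZ.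
rewrite !sub ?(bounded_linearD (L _)); try exact: bounded_measurableM.
by congr (_ +i* _); ring.
Qed.

End ComplexIntegral.

(** * Bounded measurability of z and its inverse on the unit circle *)

Section CircleFunctions.
Variable R : realType.

Lemma continuous_set_val : continuous (@set_val _ (@unit_circle R)).
Proof. exact: initial_continuous. Qed.

(** Comparing with h(0) = 0 bounds [h] by 1 on the circle; continuity makes preimages of open
    intervals open, hence Borel. The norm is [R[i]]-valued, so [complex.Re] extracts its real
    value. *)
Lemma bounded_measurable_1lip (h : R[i] -> R) :
  (forall x y, `|h x - h y| <= complex.Re `|x - y|) -> h 0 = 0 ->
  bounded_measurable (fun z : borel_circle R => h (circle_val z)).
Proof.
move=> lip h0; split; last first.
  exists 1 => z; have := lip (circle_val z) 0; rewrite h0 !subr0.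
  have -> : `|circle_val z| = 1 by have := set_valP z.
  by [].
apply: (measurability _ (RGenOpens.measurableE R)).
move=> _ [_ [a [b ->] <-]]; rewrite setTI; apply: sub_sigma_algebra.
have ch : continuous (h : (R[i])^o -> R).
  move=> x A; rewrite -nbhs_ballE => -[e /= e0 eA].
  exists e%:C; first by rewrite /= ltcR.
  move=> y /= xy; apply: eA; rewrite -ball_normE /= (le_lt_trans (lip _ _))//.
  by move: xy; rewrite ltcE => /andP[].
apply: (@open_comp _ _ (fun z : circle R => h (set_val z)) `]a, b[%classic).
  move=> z _; apply: continuous_comp; last exact: ch.
  exact: continuous_set_val.
exact: interval_open.
Qed.

Lemma cbounded_measurable_circle_val : cbounded_measurable (@circle_val R).
Proof.
split; apply: bounded_measurable_1lip => // x y.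
- have -> : complex.Re x - complex.Re y = complex.Re (x - y).
    by case: x y => ? ? [].
  by have := normc_ge_Re (x - y); rewrite lecE => /andP[].
- have -> : complex.Im x - complex.Im y = complex.Im (x - y).
    by case: x y => ? ? [].
  case: (x - y) => a b.
  by rewrite normc_def /= -sqrtr_sqr ler_wsqrtr// lerDr sqr_ge0.
Qed.

(** On the unit circle the inverse is the complex conjugate, which reduces the claim to the real and
    imaginary parts of z. *)
Lemma cbounded_measurable_circle_valV :
  cbounded_measurable (fun z => (@circle_val R z)^-1).
Proof.
have zV z : (@circle_val R z)^-1 = (circle_val z)^*%C.
  rewrite invc_norm; have -> : `|circle_val z| = 1 by have := set_valP z.
  by rewrite expr1n invr1 mul1r.
have Re_conj (u : R[i]) : complex.Re u^*%C = complex.Re u by case: u.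
have Im_conj (u : R[i]) : complex.Im u^*%C = - complex.Im u by case: u.
have [re im] := cbounded_measurable_circle_val; split.
- by under eq_fun do rewrite zV Re_conj.
- by under eq_fun do rewrite zV Im_conj; exact: bounded_measurableN.
Qed.

End CircleFunctions.

(** * Semi-infinite matrices *)

Section SemiInfinite.
Variable C : numFieldType.

(** Column-finiteness is expressed as [row_finite (itr X)], so column statements follow from row
    statements by transposition. *)
Definition row_finite (I : Type) (K : eqType) (X : I -> K -> C) :=
  forall i, exists s : seq K, forall k, k \notin s -> X i k = 0.

(** [undup] lets supports be given by any list, in particular by concatenations with repetitions. *)
Lemma imul_seq (I J : Type) (K : choiceType) (X : I -> K -> C) (Y : K -> J -> C)
    (s : seq K) i j :
  (forall k, k \notin s -> X i k * Y k j = 0) ->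
  (X ** Y) i j = \sum_(k <- undup s) X i k * Y k j.
Proof.
move=> X0; rewrite /imul (fsbigE (undup s))//; last 2 first.
- exact: undup_uniq.
- by move=> k _; rewrite mem_undup => /X0.
by apply: eq_bigl => k; rewrite in_setT.
Qed.

Lemma imul_rowl (I J : Type) (K : choiceType) (X : I -> K -> C)
    (Y : K -> J -> C) (s : seq K) i j :
  (forall k, k \notin s -> X i k = 0) ->
  (X ** Y) i j = \sum_(k <- undup s) X i k * Y k j.
Proof. by move=> X0; apply: imul_seq => k /X0->; rewrite mul0r. Qed.

Lemma itr_imul (I J : Type) (K : choiceType) (X : I -> K -> C)
    (Y : K -> J -> C) : itr (X ** Y) = itr Y ** itr X.
Proof.
apply/funext => j; apply/funext => i; rewrite /itr /imul.
by apply: eq_fsbigr => k _; rewrite mulrC.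
Qed.

Lemma itrK (I J : Type) : cancel (@itr C I J) (@itr C J I).
Proof. by []. Qed.

Lemma row_finite_imul (I : Type) (J : eqType) (K : choiceType)
    (X : I -> K -> C) (Y : K -> J -> C) :
  row_finite X -> row_finite Y -> row_finite (X ** Y).
Proof.
move=> finX finY i; have [s X0] := finX i.
have [t Y0] := choice finY.
exists (flatten [seq t k | k <- s]) => j jst.
rewrite (imul_rowl _ _ X0) big1_seq// => k /=; rewrite mem_undup => ks.
rewrite Y0 ?mulr0//; apply: contra jst => jt.
by apply/flattenP; exists (t k) => //; apply/mapP; exists k.
Qed.

Lemma row_finite_fin (I : Type) (K : finType) (X : I -> K -> C) : row_finite X.
Proof. by move=> i; exists (enum K) => k; rewrite mem_enum. Qed.

Lemma row_finite_diag (I : eqType) (D : I -> C) : row_finite (idiag D).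
Proof.
by move=> i; exists [:: i] => k; rewrite inE eq_sym /idiag => /negbTE->.
Qed.

Lemma row_finite_lower (X : nat -> nat -> C) : ilower X -> row_finite X.
Proof.
move=> lowX i; exists (iota 0 i.+1) => k.
by rewrite mem_iota /= add0n -leqNgt => /lowX.
Qed.

(** A row of [X] meets finitely many rows of [Y], each of finite support, so the double sum is
    finite whatever [Z] is and its order may be exchanged. *)
Lemma imulA_row (I J : Type) (K K' : choiceType) (X : I -> K -> C)
    (Y : K -> K' -> C) (Z : K' -> J -> C) :
  row_finite X -> row_finite Y -> X ** (Y ** Z) = X ** Y ** Z.
Proof.
move=> finX finY; apply/funext => i; apply/funext => j.
have [s X0] := finX i; have [t Y0] := choice finY.
have Y0' k l : k \in s -> l \notin flatten [seq t k | k <- s] -> Y k l = 0.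
  move=> ks lst; apply: Y0; apply: contra lst => lt.
  by apply/flattenP; exists (t k) => //; apply/mapP; exists k.
rewrite (imul_rowl _ _ X0) (@imul_seq _ _ _ _ _ (flatten [seq t k | k <- s])).
  under [RHS]eq_bigr do rewrite (imul_rowl _ _ X0) mulr_suml.
  rewrite exchange_big /=; apply: eq_big_seq => k; rewrite mem_undup => ks.
  rewrite (imul_rowl _ _ (Y0' k ^~ ks)) mulr_sumr.
  by apply: eq_bigr => l _; rewrite mulrA.
move=> l lst; rewrite (imul_rowl _ _ X0) big1_seq ?mul0r// => k /=.
by rewrite mem_undup => ks; rewrite Y0' ?mulr0.
Qed.

Lemma imulA_col (I J : Type) (K K' : choiceType) (X : I -> K -> C)
    (Y : K -> K' -> C) (Z : K' -> J -> C) :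
  row_finite (itr Y) -> row_finite (itr Z) -> X ** (Y ** Z) = X ** Y ** Z.
Proof.
move=> finY finZ; apply: (can_inj (@itrK _ _)).
by rewrite !itr_imul imulA_row.
Qed.

(** Here the double sum is cut off from both ends, by a row of [X] and a column of [Z], with [Y]
    arbitrary. *)
Lemma imulA_rowcol (I J : Type) (K K' : choiceType) (X : I -> K -> C)
    (Y : K -> K' -> C) (Z : K' -> J -> C) :
  row_finite X -> row_finite (itr Z) -> X ** (Y ** Z) = X ** Y ** Z.
Proof.
move=> finX finZ; apply/funext => i; apply/funext => j.
have [s X0] := finX i; have [t Z0] := finZ j.
have Z0' X' k l : l \notin t -> X' k l * Z l j = 0.
  by move=> /Z0; rewrite /itr => ->; rewrite mulr0.
rewrite (imul_rowl _ _ X0) (imul_seq (Z0' _ (X ** Y) i)).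
under [RHS]eq_bigr do rewrite (imul_rowl _ _ X0) mulr_suml.
rewrite exchange_big /=; apply: eq_bigr => k _.
rewrite (imul_seq (Z0' _ Y k)) mulr_sumr.
by apply: eq_bigr => l _; rewrite mulrA.
Qed.

Lemma imul_diagl (I : choiceType) (J : Type) (D : I -> C) (X : I -> J -> C) i j :
  (idiag D ** X) i j = D i * X i j.
Proof.
rewrite (@imul_seq _ _ _ _ _ [:: i]) /= ?big_seq1 /idiag ?eqxx// => k.
by rewrite inE eq_sym => /negbTE->; rewrite mul0r.
Qed.

Lemma itr_diag (I : eqType) (D : I -> C) : itr (idiag D) = idiag D.
Proof.
apply/funext => i; apply/funext => j; rewrite /itr /idiag eq_sym.
by case: eqP => [->|].
Qed.

Lemma imul_diagr (I : Type) (J : choiceType) (D : J -> C) (X : I -> J -> C) i j :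
  (X ** idiag D) i j = X i j * D j.
Proof.
rewrite -[X ** _]itrK itr_imul itr_diag /itr.
by rewrite imul_diagl mulrC.
Qed.

Lemma imul1l (J : Type) (X : nat -> J -> C) : iid C ** X = X.
Proof.
by apply/funext => i; apply/funext => j; rewrite imul_diagl mul1r.
Qed.

Lemma imul1r (I : Type) (X : I -> nat -> C) : X ** iid C = X.
Proof.
by apply/funext => i; apply/funext => j; rewrite imul_diagr mulr1.
Qed.

(** [iinv] chooses among all two-sided inverses, so a competitor [Y'] comes with no finiteness: Y' =
    (Y X) Y' = Y (X Y') = Y reassociates using only the rows of [Y] and [X]. *)
Lemma iinv_row (X Y : nat -> nat -> C) : row_finite X -> row_finite Y ->
  X ** Y = iid C -> Y ** X = iid C -> iinv X = Y.
Proof.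
move=> finX finY XY YX; rewrite /iinv; apply: xget_unique => //= Y' [XY' _].
by rewrite -[RHS]imul1r -XY' imulA_row// YX imul1l.
Qed.

Lemma iinv_col (X Y : nat -> nat -> C) :
  row_finite (itr X) -> row_finite (itr Y) ->
  X ** Y = iid C -> Y ** X = iid C -> iinv X = Y.
Proof.
move=> finX finY XY YX; rewrite /iinv; apply: xget_unique => //= Y' [_ Y'X].
by rewrite -[RHS]imul1l -Y'X -imulA_col// XY imul1r.
Qed.

(* Column [j] of the right inverse by forward substitution: entry [n] becomes
   final at step [n.+1]. *)
Fixpoint lower_solve (L : nat -> nat -> C) (j n : nat) : nat -> C :=
  if n is m.+1 then
    fun i => if i == m
             then ((m == j)%:R - \sum_(k < m) L m k * lower_solve L j m k) / L m m
             else lower_solve L j m i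
  else fun=> 0.

Lemma lower_solve_stable (L : nat -> nat -> C) j n i :
  (i < n)%N -> lower_solve L j n i = lower_solve L j i.+1 i.
Proof.
elim: n => // n IHn; rewrite ltnS leq_eqVlt => /predU1P[->//|lt_in].
by rewrite [LHS]/= (ltn_eqF lt_in) IHn.
Qed.

(** The nonzero diagonal in the conclusion allows the lemma to be applied again to the inverse it
    produces. *)
Lemma lower_right_inverse (L : nat -> nat -> C) :
  ilower L -> (forall i, L i i != 0) ->
  exists Y, [/\ ilower Y, forall i, Y i i != 0 & L ** Y = iid C].
Proof.
move=> lowL L0; pose Y i j := lower_solve L j i.+1 i.
(* Row [i] of the equation L Y = 1, solved for its last unknown. *)
have YE i j : Y i j = ((i == j)%:R - \sum_(k < i) L i k * Y k j) / L i i.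
  rewrite {1}/Y /= eqxx; congr ((_ - _) / _).
  by apply: eq_bigr => k _; rewrite lower_solve_stable.
have lowY : ilower Y.
  move=> i; elim/ltn_ind: i => i IHi j lt_ij.
  rewrite YE (ltn_eqF lt_ij) big1 ?subrr ?mul0r// => k _.
  by rewrite IHi ?mulr0// (ltn_trans _ lt_ij).
exists Y; split=> // [i|].
  rewrite YE eqxx big1 ?subr0 ?mul1r ?invr_eq0// => k _.
  by rewrite lowY ?mulr0.
apply/funext => i; apply/funext => j.
rewrite (@imul_rowl _ _ _ _ _ (iota 0 i.+1)) => [|k]; last first.
  by rewrite mem_iota /= add0n -leqNgt => /lowL.
rewrite (undup_id (iota_uniq _ _)) -[iota 0 _]/(index_iota 0 i.+1) big_mkord.
rewrite big_ord_recr /= [Y i j]YE mulrC divfK// addrC subrK.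
by rewrite /iid /idiag; case: eqP.
Qed.

(** The right inverse [Y] has itself a right inverse [X], and L = L (Y X) = (L Y) X = X; hence [Y]
    is two-sided. *)
Lemma iinv_lower (L : nat -> nat -> C) : ilower L -> (forall i, L i i != 0) ->
  [/\ ilower (iinv L), L ** iinv L = iid C & iinv L ** L = iid C].
Proof.
move=> lowL L0; have [Y [lowY Y0 LY]] := lower_right_inverse lowL L0.
have [X [lowX _ YX]] := lower_right_inverse lowY Y0.
have finL := row_finite_lower lowL; have finY := row_finite_lower lowY.
have YL : Y ** L = iid C.
  by rewrite -{1}[L]imul1r -YX [L ** _]imulA_row// LY imul1l.
by rewrite (iinv_row finL finY LY YL).
Qed.

Lemma iinv_upper (U : nat -> nat -> C) : iupper U -> (forall i, U i i != 0) ->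
  [/\ iupper (iinv U), U ** iinv U = iid C & iinv U ** U = iid C].
Proof.
move=> uppU U0; have lowU : ilower (itr U) by move=> i j; exact: uppU.
have [lowV UV VU] := iinv_lower lowU U0; set V := iinv (itr U) in lowV UV VU.
have trid : itr (iid C) = iid C by exact: itr_diag.
have UV' : U ** itr V = iid C by rewrite -trid -VU itr_imul.
have VU' : itr V ** U = iid C by rewrite -trid -UV itr_imul.
rewrite (@iinv_col U (itr V))//; last 2 first.
- exact: row_finite_lower.
- exact: row_finite_lower.
by split=> // i j; exact: lowV.
Qed.

Lemma row_finite_upper (U : nat -> nat -> C) : iupper U -> row_finite (itr U).
Proof. by move=> uppU; apply: row_finite_lower => i j; exact: uppU. Qed.

(** For bijective [S] this is a permutation matrix; multiplying by it on the left replaces row [i]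
    by row [S i], which reduces products with the shift to index arithmetic. *)
Definition relabel (S : nat -> nat) : nat -> nat -> C :=
  fun i j => (j == S i)%:R.

Lemma row_finite_relabel S : row_finite (relabel S).
Proof.
by move=> i; exists [:: S i] => k; rewrite inE /relabel => /negbTE->.
Qed.

Lemma relabelE S (J : Type) (X : nat -> J -> C) i j :
  (relabel S ** X) i j = X (S i) j.
Proof.
rewrite (@imul_rowl _ _ _ _ _ [:: S i]) /= ?big_seq1 /relabel ?eqxx ?mul1r// => k.
by rewrite inE => /negbTE->.
Qed.

Lemma iinv_relabel S T : cancel S T -> cancel T S ->
  iinv (relabel S) = relabel T.
Proof.
move=> ST TS; apply: iinv_row; try exact: row_finite_relabel.
- apply/funext => i; apply/funext => j; rewrite relabelE /relabel ST.
  by rewrite /iid /idiag eq_sym; case: eqP.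
- apply/funext => i; apply/funext => j; rewrite relabelE /relabel TS.
  by rewrite /iid /idiag eq_sym; case: eqP.
Qed.

End SemiInfinite.

(** * The shift, its integer powers and the Laurent monomials *)

Section Shift.
Variables (C : numFieldType) (q : nat).
Hypothesis q_gt0 : (0 < q)%N.

(** Blocks list the exponents in the order 0, -1, 1, -2, 2, ...; this map raises the exponent by
    one, so block 1 (exponent -1) goes to block 0. *)
Definition block_succ (m : nat) : nat :=
  if ~~ odd m then m.+2 else if m == 1%N then 0%N else m.-2.

Definition block_pred (m : nat) : nat :=
  if odd m then m.+2 else if m == 0%N then 1%N else m.-2.

Lemma block_succK : cancel block_succ block_pred.
Proof.
move=> [|[|m]]; rewrite /block_succ /block_pred //= ?negbK.
by case om: (odd m); rewrite /= ?negbK om.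
Qed.

Lemma block_predK : cancel block_pred block_succ.
Proof.
move=> [|[|m]]; rewrite /block_succ /block_pred //= ?negbK.
by case om: (odd m); rewrite /= ?negbK om.
Qed.

Lemma upsilon_blockE m n : upsilon_block m n = (n == block_succ m).
Proof.
rewrite /upsilon_block /block_succ; case: m => [|[|m]] /=.
- by rewrite orbF.
- by rewrite addn2 orbF.
- rewrite !addn2; case om: (odd m) => /=; last by rewrite orbF.
  by rewrite !eqSS eq_sym.
Qed.

Lemma block_monomial_succ m (z : C) : z != 0 ->
  block_monomial (block_succ m) z = z * block_monomial m z.
Proof.
move=> z0; rewrite /block_monomial /block_succ.
case: m => [|[|m]] /=; first by rewrite mulr1 expr1.
  by rewrite expr0 expr1 divff.
case om: (odd m) => /=; rewrite om /=; last by rewrite -exprS.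
by rewrite [in RHS]exprS invfM mulrA divff// mul1r.
Qed.

Definition on_blocks (S : nat -> nat) (i : nat) : nat :=
  (S (i %/ q) * q + i %% q)%N.

Lemma on_blocks_div S i : (on_blocks S i %/ q = S (i %/ q))%N.
Proof. by rewrite /on_blocks divnMDl// (divn_small (ltn_pmod _ _)) ?addn0. Qed.

Lemma on_blocks_mod S i : (on_blocks S i %% q = i %% q)%N.
Proof. by rewrite /on_blocks modnMDl modn_mod. Qed.

Lemma on_blocksK S T : cancel S T -> cancel (on_blocks S) (on_blocks T).
Proof.
move=> ST i; rewrite {1}/on_blocks on_blocks_div on_blocks_mod ST.
by rewrite -divn_eq.
Qed.

Lemma Upsilon_relabel : Upsilon q = relabel C (on_blocks block_succ).
Proof.
apply/funext => i; apply/funext => j; rewrite /Upsilon /relabel.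
rewrite upsilon_blockE; congr (nat_of_bool _)%:R; apply/andP/eqP.
- by move=> [/eqP jd /eqP im]; rewrite [LHS](divn_eq j q) jd -im.
- by move=> ->; rewrite on_blocks_div on_blocks_mod.
Qed.

Lemma iinv_Upsilon : iinv (Upsilon q) = relabel C (on_blocks block_pred).
Proof.
rewrite Upsilon_relabel; apply: iinv_relabel; apply: on_blocksK.
- exact: block_succK.
- exact: block_predK.
Qed.

Lemma row_finite_Upsilon_ipow k : row_finite (ipow (Upsilon q : _ -> _ -> C) k).
Proof.
case: k => n /=.
- elim: n => [|n IHn]; first exact: row_finite_diag.
  by rewrite Upsilon_relabel; apply: row_finite_imul (row_finite_relabel _ _) _;
    rewrite -Upsilon_relabel.
- rewrite iinv_Upsilon -iterS; elim: n.+1 => [|m IHm].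
    exact: row_finite_diag.
  exact: row_finite_imul (row_finite_relabel _ _) IHm.
Qed.

Lemma row_finite_Upsilon_pow (b : 'I_q) k :
  row_finite (Upsilon_pow b k : _ -> _ -> C).
Proof.
exact: row_finite_imul (row_finite_Upsilon_ipow k) (row_finite_diag _).
Qed.

Lemma Zmx_succ (z : C) i s : z != 0 ->
  Zmx q z (on_blocks block_succ i) s = z * Zmx q z i s.
Proof.
move=> z0; rewrite /Zmx on_blocks_mod on_blocks_div.
by case: ifP => _; rewrite ?mulr0// block_monomial_succ.
Qed.

Lemma Zmx_pred (z : C) i s : z != 0 ->
  Zmx q z (on_blocks block_pred i) s = z^-1 * Zmx q z i s.
Proof.
move=> z0; apply: (mulfI z0); rewrite -Zmx_succ// mulrA divff// mul1r.
by rewrite (on_blocksK block_predK).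
Qed.

(** Scaling columns by [D] preserves the eigenvector relation; taking [D] to be the indicator of [b]
    later absorbs the projection [Iproj b]. *)
Lemma Upsilon_ipow_Zmx k (z : C) (D : 'I_q -> C) i s : z != 0 ->
  (ipow (Upsilon q) k ** (fun i s => Zmx q z i s * D s)) i s
  = z ^ k * (Zmx q z i s * D s).
Proof.
move=> z0; case: k => n /=.
- rewrite -exprnP; elim: n i => [|n IHn] i.
    by rewrite /= imul1l mul1r.
  rewrite [iter _ _ _]/= {1}Upsilon_relabel -imulA_row.
  + by rewrite relabelE IHn Zmx_succ// exprSr; ring.
  + exact: row_finite_relabel.
  + exact: (row_finite_Upsilon_ipow n).
- rewrite NegzE -exprnN -exprVn -iterS; elim: n.+1 i => {n}[|n IHn] i.
    by rewrite /= imul1l mul1r.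
  rewrite [iter _ _ _]/= {1}iinv_Upsilon -imulA_row.
  + by rewrite relabelE IHn Zmx_pred// exprSr; ring.
  + exact: row_finite_relabel.
  (* The iterate of order [n.+1] is the power of exponent [Negz n]; order 0, the identity, is
     treated apart. *)
  + case: n {IHn} => [|n]; first exact: row_finite_diag.
    exact: (row_finite_Upsilon_ipow (Negz n)).
Qed.

Lemma Upsilon_pow_Zmx (b : 'I_q) k (z : C) i s : z != 0 ->
  (Upsilon_pow b k ** Zmx q z) i s = z ^ k * (Zmx q z i s * (s == b)%:R).
Proof.
move=> z0; rewrite /Upsilon_pow -imulA_row; last 2 first.
- exact: row_finite_Upsilon_ipow.
- exact: row_finite_diag.
apply: eq_trans (Upsilon_ipow_Zmx k (fun s => (s == b)%:R) i s z0).
(* Row [i] of [Zmx] is supported in column [i %% q], so selecting the rows of class [b] amounts to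
   selecting column [b]. *)
congr ((_ ** _) i s).
apply/funext => {}i; apply/funext => {}s; rewrite imul_diagl /Zmx.
case: ifP => [/eqP|]; last by rewrite mulr0 mul0r.
by move=> ->; rewrite mulrC; congr (_ * _%:R).
Qed.

Variables (d : nat) (c : 'I_q -> C) (zeta : 'I_q -> 'I_(2 * d) -> C).

Lemma Wlaurent_sum b z : z != 0 -> Wlaurent c zeta b z =
  \sum_(k < (2 * d).+1) (Wnum c zeta b)`_k * z ^ (k%:Z - d%:Z).
Proof.
move=> z0; rewrite /Wlaurent (@horner_coef_wide _ (2 * d).+1).
  rewrite mulr_sumr; apply: eq_bigr => k _.
  by rewrite expfzDr// -exprnN -exprnP; ring.
rewrite (leq_trans (size_scale_leq _ _))// size_prod_XsubC.
by rewrite -[X in (_ <= X.+1)%N]card_ord cardE /index_enum -enumT.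
Qed.

(** A single list serves all [b] and all exponents occurring in [Wcal], so that every term can be
    summed over the same finite index set. *)
Lemma Wcal_support i : exists s : seq nat, forall b (k : int),
  (`|k| <= d)%N -> forall j, j \notin s -> Upsilon_pow (b : 'I_q) k i j = 0 :> C.
Proof.
have H (bk : 'I_q * 'I_(2 * d).+1) : exists s : seq nat, forall j,
    j \notin s -> Upsilon_pow bk.1 (bk.2%:Z - d%:Z) i j = 0 :> C.
  exact: row_finite_Upsilon_pow.
have [s s0] := choice H.
exists (flatten [seq s bk | bk <- enum {: 'I_q * 'I_(2 * d).+1}]) => b k kd j.
(* The exponent [k] corresponds to the coefficient index [k + d]. *)
have kd2 : (`|(k + d%:Z)%R| < (2 * d).+1)%N by lia.
move=> js; have := s0 (b, Ordinal kd2) j; rewrite /= gez0_abs; last lia.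
rewrite addrK; apply; apply: contra js => js; apply/flattenP.
by eexists; last exact: js; apply: map_f; rewrite mem_enum.
Qed.

Lemma row_finite_Wcal : row_finite (Wcal c zeta).
Proof.
move=> i; have [s s0] := Wcal_support i; exists s => j js.
rewrite /Wcal big1// => b _; rewrite big1// => k _.
by rewrite (s0 _ _ _ _ js) ?mulr0//; have := ltn_ord k; lia.
Qed.

Lemma Wcal_Zmx z : z != 0 ->
  Wcal c zeta ** Zmx q z = Zmx q z ** Wdiag c zeta z.
Proof.
move=> z0; apply/funext => i; apply/funext => b; rewrite imul_diagr.
have [s s0] := Wcal_support i.
have kd (k : 'I_(2 * d).+1) : (`|k%:Z - d%:Z| <= d)%N.
  by have := ltn_ord k; lia.
rewrite (@imul_seq _ _ _ _ _ _ s) => [|j js]; last first.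
  rewrite /Wcal big1 ?mul0r// => b' _; rewrite big1// => k _.
  by rewrite (s0 _ _ (kd k) _ js) mulr0.
rewrite /Wcal; under eq_bigr do rewrite mulr_suml.
(* In column [b] only the summand of index [b] survives, and its coefficients reassemble W_b(z). *)
rewrite exchange_big /= (bigD1 b)//= [X in _ + X]big1 ?addr0 => [|b' b'b].
  under eq_bigr do rewrite mulr_suml.
  rewrite exchange_big Wlaurent_sum// mulr_sumr; apply: eq_bigr => k _ /=.
  under eq_bigr do rewrite -mulrA.
  rewrite -mulr_sumr -(imul_rowl _ _ (s0 b _ (kd k))) Upsilon_pow_Zmx//.
  by rewrite eqxx mulr1; ring.
under eq_bigr do rewrite mulr_suml.
rewrite exchange_big big1//= => k _.
under eq_bigr do rewrite -mulrA.
rewrite -mulr_sumr -(imul_rowl _ _ (s0 b' _ (kd k))) Upsilon_pow_Zmx//.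
by rewrite eq_sym (negbTE b'b) !mulr0.
Qed.

End Shift.

(** * Moment matrices under the Geronimus transformation and the connection formulas *)

Section Geronimus.
Variable R : realType.

(** A general [F] covers both factors of the moment integrand, evaluated at z and at its inverse. *)
Lemma cbounded_measurable_Zmx r (F : borel_circle R -> R[i]) i s :
  cbounded_measurable F -> cbounded_measurable (fun z => (F z)^-1) ->
  cbounded_measurable (fun z => Zmx r (F z) i s).
Proof.
move=> bF bFV; rewrite /Zmx /block_monomial.
case: (_ == _); last exact: cbounded_measurable_cst.
case: (odd _); last exact: cbounded_measurableX.
by under eq_fun do rewrite -exprVn; exact: cbounded_measurableX.
Qed.

Variables (p q d : nat) (c : 'I_q -> R[i]) (zeta : 'I_q -> 'I_(2 * d) -> R[i]).

Lemma cbounded_measurable_Wlaurent b :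
  cbounded_measurable (fun z => Wlaurent c zeta b (@circle_val R z)).
Proof.
have bz := @cbounded_measurable_circle_val R.
apply: cbounded_measurableM.
  under eq_fun do rewrite -exprVn.
  exact/cbounded_measurableX/cbounded_measurable_circle_valV.
under eq_fun do rewrite horner_coef.
apply: cbounded_measurable_sum => k; apply: cbounded_measurableM.
  exact: cbounded_measurable_cst.
exact: cbounded_measurableX.
Qed.

Lemma circle_val_neq0 (z : borel_circle R) : circle_val z != 0.
Proof.
rewrite -normr_eq0; have -> : `|circle_val z| = 1 by have := set_valP z.
exact: oner_neq0.
Qed.

Lemma Wcal_moment_matrix
    (mu muc : 'M[complex_measure (borel_circle R) R]_(q, p)) :
  (0 < q)%N -> geronimus c zeta mu muc ->
  Wcal c zeta ** moment_matrix muc = moment_matrix mu.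
Proof.
move=> q0 muW; apply/funext => i; apply/funext => j.
have [s s0] := row_finite_Wcal q0 c zeta i.
have bval := @cbounded_measurable_circle_val R.
have bvalV := @cbounded_measurable_circle_valV R.
have bZ k b : cbounded_measurable (fun z => Zmx q (@circle_val R z) k b).
  exact: cbounded_measurable_Zmx.
have bZV a : cbounded_measurable (fun z => Zmx p (@circle_val R z)^-1 j a).
  apply: cbounded_measurable_Zmx => //.
  by under eq_fun do rewrite invrK.
rewrite (imul_rowl _ _ s0) /moment_matrix.
under eq_bigr do rewrite mulr_sumr.
rewrite exchange_big /=; apply: eq_bigr => b _.
under eq_bigr do rewrite mulr_sumr.
rewrite exchange_big /=; apply: eq_bigr => a _.
(* Row [i] of [Wcal] has finite support, so its sum moves under the integral. The density then
   carries the other side to [muc], and the eigenvector relation identifies the integrands. *)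
rewrite -cintegral_sum => [|k]; last exact: cbounded_measurableM.
rewrite (cintegral_density (cbounded_measurable_Wlaurent b) (muW b a)).
  congr cintegral; apply/funext => z; under eq_bigr do rewrite mulrA.
  rewrite -mulr_suml -(imul_rowl _ _ s0) Wcal_Zmx//; last exact: circle_val_neq0.
  by rewrite imul_diagr mulrAC.
exact: cbounded_measurableM.
Qed.

End Geronimus.

Theorem proposition4p2 (R : realType) (p q d : nat)
    (c : 'I_q -> R[i]) (zeta : 'I_q -> 'I_(2 * d) -> R[i])
    (mu muc : 'M[complex_measure (borel_circle R) R]_(q, p))
    (L U Lc Uc : nat -> nat -> R[i]) :
  (0 < p)%N -> (0 < q)%N -> (0 < d)%N ->
  (forall b, c b != 0) ->
  (forall b l, zeta b l != 0) ->
  injective (fun bl : 'I_q * 'I_(2 * d) => zeta bl.1 bl.2) ->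
  geronimus c zeta mu muc ->
  gauss_borel (moment_matrix mu) L U ->
  gauss_borel (moment_matrix muc) Lc Uc ->
  let NG := iinv U ** Uc in
  NG = L ** Wcal c zeta ** iinv Lc /\
  forall z : R[i], z != 0 ->
    [/\ NG ** Bpoly q Lc z = Bpoly q L z ** Wdiag c zeta z,
        forall b : 'I_q,
          NG ** icol b (Bpoly q Lc z)
          = iscale (icol b (Bpoly q L z)) (Wlaurent c zeta b z),
        Apoly p U z^-1 ** NG = Apoly p Uc z^-1
      & forall a : 'I_p,
          irow a (Apoly p U z^-1) ** NG = irow a (Apoly p Uc z^-1)].
Proof.
move=> _ q0 _ _ _ _ muW [lowL uppU L0 U0 ME] [lowLc uppUc Lc0 Uc0 McE] NG.
have [lowLV LLV LVL] := iinv_lower lowL L0.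
have [uppUV UUV _] := iinv_upper uppU U0.
have [lowLcV _ LcVLc] := iinv_lower lowLc Lc0.
have [uppUcV _ UcVUc] := iinv_upper uppUc Uc0.
have finL := row_finite_lower lowL; have finLV := row_finite_lower lowLV.
have finLc := row_finite_lower lowLc; have finLcV := row_finite_lower lowLcV.
have finU := row_finite_upper uppU; have finUV := row_finite_upper uppUV.
have finUc := row_finite_upper uppUc.
have finW := row_finite_Wcal q0 c zeta.
have finLW := row_finite_imul finL finW.
have finX := row_finite_imul finLW finLcV.
(* From the two factorizations: U^-1 = L M = L W Mc = L W Lc^-1 Uc^-1, reassociated through
   row-finite left factors. *)
have UVE : iinv U = L ** Wcal c zeta ** iinv Lc ** iinv Uc.
  rewrite -[LHS]imul1l -LLV -imulA_row// -ME -(Wcal_moment_matrix q0 muW) McE.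
  by rewrite (imulA_row _ finL finW) (imulA_row _ finLW finLcV).
have NGE : NG = L ** Wcal c zeta ** iinv Lc.
  (* Cancelling Uc^-1 Uc uses the mixed law: the left factor is row-finite and [Uc]
     column-finite. *)
  by rewrite /NG UVE -(imulA_rowcol _ finX finUc) UcVUc imul1r.
split=> // z z0.
have NGB : NG ** Bpoly q Lc z = Bpoly q L z ** Wdiag c zeta z.
  rewrite NGE /Bpoly (imulA_row _ finX finLc).
  rewrite -[_ ** _ ** Lc](imulA_row _ finLW finLcV) LcVLc imul1r.
  rewrite -(imulA_row _ finL finW) Wcal_Zmx// imulA_row//.
  exact: row_finite_fin.
have ANG : Apoly p U z^-1 ** NG = Apoly p Uc z^-1.
  (* As a product of two upper triangular matrices, [NG] is also column-finite. *)
  have finNG : row_finite (itr NG) by rewrite itr_imul; exact: row_finite_imul.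
  by rewrite /Apoly -(imulA_col _ finU finNG) /NG (imulA_col _ finUV finUc)
    UUV imul1l.
split=> // [b|a].
(* Extracting a column commutes with left multiplication by conversion, as does extracting a row
   with right multiplication. *)
- rewrite -[LHS]/(icol b (NG ** Bpoly q Lc z)) NGB.
  apply/funext => i; apply/funext => j.
  by rewrite /icol imul_diagr.
- by rewrite -[LHS]/(irow a (Apoly p U z^-1 ** NG)) ANG.
Qed.
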